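(* Fix an integer $p\ge 1$. There exists a constant $K_p\in(0,\infty)$ with the following property. For every sufficiently large integer $n$ there exist a set $P\subseteq\mathbb{Z}$ with exactly $n$ elements and a real number $A$ such that for every $B_1,\dots,B_{p-1}\in\mathbb{R}$ the set \[ \big\{(Ak^p+B_{p-1}k^{p-1}+\cdots+B_1k)\bmod 1 \,:\, k\in P\big\}\subseteq\mathbb{T} \] intersects every interval on $\mathbb{T}$ of length \[ \varepsilon_n=K_p\,\frac{\log n}{n}. \]
   Context: $\mathbb{T}=\mathbb{R}/\mathbb{Z}$ is the one-dimensional torus, and $t\bmod 1:=t+\mathbb{Z}\in\mathbb{T}$ for $t\in\mathbb{R}$. An interval on $\mathbb{T}$ is the image of an interval $I\subseteq\mathbb{R}$ under the canonical projection $\mathbb{R}\to\mathbb{T}$; lengths on $\mathbb{T}$ are measured by the Lebesgue measure transferred from $[0,1)$. For $p=1$ there are no coefficients $B_i$ and the set is $\{Ak\bmod 1: k\in P\}$. The logarithm has base $e$. *)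

(* Defs.v *)
From mathcomp Require Import all_boot all_order all_algebra.
From mathcomp Require Import finmap.
From mathcomp Require Import all_classical all_reals all_analysis.

Set Implicit Arguments.
Unset Strict Implicit.
Unset Printing Implicit Defensive.

Import Order.TTheory GRing.Theory Num.Theory.

Local Open Scope classical_set_scope.
Local Open Scope ring_scope.

(* R / Z as a quotient of additive groups: Z is a subgroup of R but not an
   ideal, so the library's notation for ring quotients does not apply.
   [int_num_subdef] is the predicate underlying the qualifier [Num.int]. *)
Definition torus (R : realType) : Type :=
  Quotient.quot (GRing.ZmodClosed.clone R archimedean.Num.int_num_subdef _).

Definition torus_proj (R : realType) (t : R) : torus R := \pi_(torus R)%qT t.

Lemma torus_projP (R : realType) (x y : R) :
  torus_proj x = torus_proj y <-> exists m : int, x - y = m%:~R.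
Proof.
rewrite /torus_proj; split => [/eqP|[m xy]].
  by rewrite -Quotient.idealrBE => /intrP.
by apply/eqP; rewrite -Quotient.idealrBE; apply/intrP; exists m.
Qed.

Definition torus_interval (R : realType) (J : set (torus R)) : Prop :=
  exists2 I : set R, is_interval I & J = @torus_proj R @` I.

(* Lebesgue measure transferred from [0, 1[, a fundamental domain for Z. *)
Definition torus_length (R : realType) (J : set (torus R)) : \bar R :=
  lebesgue_measure (`[0, 1[ `&` @torus_proj R @^-1` J : set R).

Definition torus_poly_set (R : realType) (p : nat) (P : {fset int}) (A : R)
    (B : nat -> R) : set (torus R) :=
  [set torus_proj (A * k%:~R ^+ p + \sum_(1 <= i < p) B i * k%:~R ^+ i)
     | k in [set` P]].

(* Main.v *)
Require Import Defs.
From mathcomp Require Import all_boot all_order all_algebra.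
From mathcomp Require Import finmap.
From mathcomp Require Import all_classical all_reals all_analysis.
From mathcomp Require Import ring lra zify.
Import Order.TTheory GRing.Theory Num.Theory numFieldNormedType.Exports.
Local Open Scope classical_set_scope.
Local Open Scope ring_scope.
Set Implicit Arguments.
Unset Strict Implicit.
Unset Printing Implicit Defensive.

(** The proof is probabilistic in spirit: a random sample of [n] points from a
    large well-distributed set of integers works for all coefficients at once.

    Write [p = d + 1], take [A = 1 / q], and let [k] range over the sums
    [x_1 + ... + x_d + y] with [x_i] in [0, H) and [y] in [0, q), counted with
    multiplicity. Differencing in [x_1], ..., [x_d] in turn removes the lower
    coefficients and leaves a linear phase in [y] with frequency
    [m * p! * h_1 * ... * h_d / q]. If no [h_i] vanishes and [q] is large, this
    frequency is not an integer and the sum over a full period is exactly zero;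
    some [h_i] vanishes with probability at most [d / H]. Thus all trigonometric
    sums of [f(k)] of bounded frequency are small, uniformly in the lower
    coefficients ([weyl_box_sums]). A trigonometric polynomial that is
    nonpositive off a short arc turns this into a lower bound of the right order
    for the proportion of [k] with [f(k)] in that arc ([count_cosT_ge]).

    The values of [f] depend continuously on its coefficients, so only
    polynomially many (in [n]) polynomials matter; the position of the target
    interval is absorbed into the constant coefficient. For a target of length
    [K log n / n], each polynomial is missed by [n] random points with
    probability at most a power [n ^ (- c K)], which beats the number of
    polynomials when [K] is large. The random choice is replaced by a greedy one
    ([greedy_hitting]). Finally an interval of the torus of length [eps <= 1]
    contains the projection of a genuine interval of length comparable to [eps]
    ([torus_interval_center]). *)

(** * Cosines on the circle *)
Definition cosT (R : realType) (x : R) : R := cos (2 * pi * x).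
Definition sinT (R : realType) (x : R) : R := sin (2 * pi * x).

Lemma cosT_le1 (R : realType) (x : R) : cosT x <= 1.
Proof. exact: cos_le1. Qed.

Lemma cosT_geN1 (R : realType) (x : R) : -1 <= cosT x.
Proof. exact: cos_geN1. Qed.

Lemma cosTN (R : realType) (x : R) : cosT (- x) = cosT x.
Proof. by rewrite /cosT mulrN cosN. Qed.

Lemma cosTB (R : realType) (x y : R) :
  cosT (x - y) = cosT x * cosT y + sinT x * sinT y.
Proof. by rewrite /cosT mulrBr cosB. Qed.

Lemma sinTD (R : realType) (x y : R) :
  sinT (x + y) = sinT x * cosT y + cosT x * sinT y.
Proof. by rewrite /sinT mulrDr sinD. Qed.

Lemma sinTB (R : realType) (x y : R) :
  sinT (x - y) = sinT x * cosT y - cosT x * sinT y.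
Proof. by rewrite /sinT mulrBr sinB. Qed.

Lemma cosTDint (R : realType) (x : R) (m : int) : cosT (x + m%:~R) = cosT x.
Proof.
have cosTDnat (y : R) (n : nat) : cosT (y + n%:R) = cosT y.
  rewrite /cosT -[RHS](periodicn (@cosD2pi R) n).
  have -> : 2 * pi * (y + n%:R) = 2 * pi * y + pi *+ 2 *+ n :> R.
    by rewrite -[pi *+ 2 *+ n]mulr_natr -[pi *+ 2]mulr_natr; ring.
  by [].
case: m => n; first exact: cosTDnat.
have -> : x + (Negz n)%:~R = x - n.+1%:R by rewrite NegzE mulrNz.
by rewrite -[LHS](cosTDnat _ n.+1) subrK.
Qed.

Lemma sinTDint (R : realType) (x : R) (m : int) : sinT (x + m%:~R) = sinT x.
Proof.
have sinTE (y : R) : sinT y = cosT (y - 4^-1).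
  rewrite /sinT -(cosBpihalf (2 * pi * y)) /cosT.
  have -> : 2 * pi * (y - 4^-1) = 2 * pi * y - pi / 2 by field.
  by [].
by rewrite !sinTE addrAC cosTDint.
Qed.

(** Multiplying by twice the sine of half the step turns each cosine into a
    difference of consecutive sines, so the sum telescopes. *)
Lemma sum_cosT_arith (R : realType) (a b : R) (N : nat) :
  2 * sinT (a / 2) * \sum_(x < N) cosT (a * x%:R + b) =
  sinT (a * N%:R + b - a / 2) - sinT (b - a / 2).
Proof.
elim: N => [|N IH]; first by rewrite big_ord0 mulr0 !mulr0 add0r subrr.
rewrite big_ord_recr /= mulrDr IH.
have -> : a * N.+1%:R + b - a / 2 = (a * N%:R + b) + a / 2.
  by rewrite -natr1; field.
by rewrite (sinTD _ (a / 2)) (sinTB (a * N%:R + b)); ring.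
Qed.

(** A progression of frequency [c / q] returns to its start after [q] steps, so
    the telescoped sum vanishes, and the sine factored out of it is nonzero
    because [q] does not divide [c]. *)
Lemma sum_cosT_period (R : realType) (q : nat) (c : int) (b : R) :
  c != 0 -> (`|c| < q)%N -> \sum_(x < q) cosT (c%:~R / q%:R * x%:R + b) = 0.
Proof.
move=> c0 cq; have q0 : 0 < q%:R :> R by rewrite ltr0n; lia.
set a : R := c%:~R / q%:R.
have := sum_cosT_arith a b q.
have -> : a * q%:R + b - a / 2 = (b - a / 2) + c%:~R.
  by rewrite /a divfK ?gt_eqF//; ring.
rewrite sinTDint subrr => /eqP; rewrite mulf_eq0 => /orP[|/eqP//].
rewrite mulf_eq0 pnatr_eq0 /= => /eqP sa.
have sa0 : sinT (`|a| / 2) = 0.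
  case: (ger0P a) => _; first by [].
  by rewrite mulNr /sinT mulrN sinN -/(sinT _) sa oppr0.
have a0 : 0 < `|a|.
  by rewrite normr_gt0 mulf_neq0 ?intr_eq0 ?invr_eq0 ?(gt_eqF q0).
have a1 : `|a| < 1.
  rewrite normrM normfV (gtr0_norm q0) ltr_pdivrMr// mul1r.
  by rewrite -intr_norm -[q%:R]/(q%:Z%:~R) ltr_int -abszE ltz_nat.
suff: 0 < sinT (`|a| / 2) by rewrite sa0 ltxx.
apply: sin_gt0_pi.
have -> : 2 * pi * (`|a| / 2) = pi * `|a| by field.
rewrite mulr_gt0 ?pi_gt0//=.
by rewrite -[ltRHS]mulr1 ltr_pM2l ?pi_gt0.
Qed.

(** * Weyl differencing on sums of independent variables *)

(** Cauchy-Schwarz against the constant function 1: expand the nonnegative sum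
    of squared deviations from the mean. *)
Lemma sqr_sum_le_size (R : realFieldType) (T : Type) (s : seq T) (a : T -> R) :
  (\sum_(y <- s) a y) ^+ 2 <= (size s)%:R * \sum_(y <- s) a y ^+ 2.
Proof.
case: (posnP (size s)) => [/size0nil ->|s0].
  by rewrite !big_nil expr0n mulr0.
set S := \sum_(y <- s) a y; set V := \sum_(y <- s) _.
have N0 : 0 < (size s)%:R :> R by rewrite ltr0n.
set N : R := (size s)%:R in N0 *.
have : 0 <= \sum_(y <- s) (a y - S / N) ^+ 2 by apply: sumr_ge0 => y _; exact: sqr_ge0.
have -> : \sum_(y <- s) (a y - S / N) ^+ 2 = V - S ^+ 2 / N.
  transitivity (\sum_(y <- s) (a y ^+ 2 + (a y * (- 2 * (S / N)) + (S / N) ^+ 2))).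
    by apply: eq_bigr => y _; ring.
  rewrite !big_split /= -mulr_suml -/S -/V big_const_seq count_predT iter_addr_0.
  by rewrite -mulr_natr -/N; field; rewrite gt_eqF.
by rewrite subr_ge0 ler_pdivrMr// mulrC.
Qed.

(** The list, with multiplicity, of the values of [x_1 + ... + x_d + y] with
    every [x_i] in [0, H) and [y] in [0, q). An interval of integers would force
    boundary terms into each differencing step; here each step removes exactly
    one of the independent variables [x_i]. The range of [y] is a full period of
    the leading coefficient. *)
Fixpoint box_sums (H q d : nat) : seq nat :=
  if d is d'.+1 then [seq (x + y)%N | x <- iota 0 H, y <- box_sums H q d']
  else iota 0 q.

Lemma size_box_sums (H q d : nat) : size (box_sums H q d) = (H ^ d * q)%N.
Proof.
elim: d => [|d IH] /=; first by rewrite size_iota expn0 mul1n.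
by rewrite size_allpairs size_iota IH expnS mulnA.
Qed.

Lemma box_sums_le (H q d k : nat) : k \in box_sums H q d -> (k <= d * H + q)%N.
Proof.
elim: d k => [|d IH] k /=; first by rewrite mem_iota; lia.
case/allpairsP => -[x y] /= [xH /IH yB ->].
by move: xH; rewrite mem_iota; lia.
Qed.

Lemma big_box_sums (R : nmodType) (H q d : nat) (F : nat -> R) :
  \sum_(k <- box_sums H q d.+1) F k =
  \sum_(x < H) \sum_(y <- box_sums H q d) F (x + y)%N.
Proof.
rewrite -(big_mkord xpredT (fun x => \sum_(y <- box_sums H q d) F (x + y)%N)).
by rewrite /index_iota subn0 /= big_allpairs_dep.
Qed.

Lemma coef_comp_XaddC (R : comNzRingType) (f : {poly R}) (a : R) (j : nat) :
  (f \Po ('X + a%:P))`_j =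
  \sum_(i < size f) f`_i * (a ^+ (i - j) *+ 'C(i, j)).
Proof.
rewrite comp_polyE coef_sum; apply: eq_bigr => i _.
rewrite coefZ; congr (_ * _).
rewrite addrC exprDn coef_sum.
have E (k : 'I_i.+1) :
    (a%:P ^+ (i - k) * 'X^k *+ 'C(i, k))`_j =
    if k == j :> nat then a ^+ (i - j) *+ 'C(i, j) else 0.
  rewrite coefMn -polyC_exp coefCM coefXn eq_sym.
  by case: eqP => [->|]; rewrite ?mulr1 // mulr0 mul0rn.
rewrite (eq_bigr _ (fun k _ => E k)) -big_mkcond /=.
case: (leqP j i) => ji.
  by rewrite (big_pred1 (Ordinal (ji : (j < i.+1)%N))).
rewrite bin_small// mulr0n big_pred0// => k.
by apply/eqP => kj; have := ltn_ord k; rewrite kj ltnS leqNgt ji.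
Qed.

(** The differencing step: subtracting two shifts cancels the coefficient of
    ['X^(d.+1)], and the new top coefficient depends on the old one and the
    shifts only. The arbitrary lower coefficients never enter the bookkeeping. *)
Lemma shift_diff_poly (R : comNzRingType) (f : {poly R}) (d : nat) (a b : R) :
  (size f <= d.+2)%N ->
  exists g : {poly R}, [/\ (size g <= d.+1)%N,
    g`_d = f`_d.+1 * d.+1%:R * (a - b) &
    forall y, g.[y] = f.[a + y] - f.[b + y]].
Proof.
move=> sf; exists ((f \Po ('X + a%:P)) - (f \Po ('X + b%:P))).
have E (c : R) (j : nat) : (f \Po ('X + c%:P))`_j =
    \sum_(i < d.+2) f`_i * (c ^+ (i - j) *+ 'C(i, j)).
  rewrite coef_comp_XaddC (big_ord_widen _ (fun i => f`_i * (c ^+ (i - j) *+ 'C(i, j))) sf).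
  rewrite big_mkcond /=; apply: eq_bigr => i _.
  by case: ltnP => // fi; rewrite nth_default// mul0r.
split.
- apply/leq_sizeP => j dj; rewrite coefB !E big_ord_recr [X in _ - X]big_ord_recr /=.
  have S0 (c : R) : \sum_(i < d.+1) f`_i * (c ^+ (i - j) *+ 'C(i, j)) =
      \sum_(i < d.+1) f`_i * (0 *+ 'C(i, j)).
    apply: eq_bigr => i _; rewrite bin_small ?mulr0n//.
    exact: leq_trans (ltn_ord i) dj.
  by rewrite !S0 (eqP (_ : d.+1 - j == 0)%N) ?subrr// subn_eq0.
- rewrite coefB !E !big_ord_recr /=.
  have S0 (c : R) : \sum_(i < d) f`_i * (c ^+ (i - d) *+ 'C(i, d)) = 0.
    by apply: big1 => i _; rewrite bin_small ?mulr0n ?mulr0.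
  rewrite (S0 a) (S0 b) subnn subSnn binn binSn !expr1 !expr0.
  rewrite -(mulr_natr a d.+1) -(mulr_natr b d.+1).
  by ring.
- by move=> y; rewrite hornerD hornerN !horner_comp !hornerE ![y + _]addrC.
Qed.

(** Weyl's inequality, by induction on the degree. Cauchy-Schwarz over the
    other variables bounds the square of the sum by the sum over pairs
    [(x, x')] of the sums attached to [f.[x + y] - f.[x' + y]]. A pair with
    [x = x'] is bounded trivially, and such pairs have proportion [1 / H]. In
    every other pair the numerator [c] is multiplied by [d.+2 * (x - x')], which
    is nonzero; the hypothesis on [q] keeps the numerator below [q] down to
    degree one, where the sum over a full period vanishes. A bound [2 u^2] in
    one degree gives [u^2 + 2 u^2 <= (2 u)^2] for the square in the next
    degree, which accounts for the exponent [2 ^ d]. *)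
Lemma weyl_box_sums (R : realType) (d H q : nat) (u : R) (f : {poly R}) (c : int) :
  (0 < H)%N -> 0 <= u -> u <= 1 -> H%:R^-1 <= u ^+ (2 ^ d) ->
  (size f <= d.+2)%N -> f`_d.+1 = c%:~R / q%:R ->
  c != 0 -> (`|c| * (d.+1)`! * H ^ d < q)%N ->
  `|\sum_(k <- box_sums H q d) cosT f.[k%:R]| <= 2 * u * (size (box_sums H q d))%:R.
Proof.
move=> H0; elim: d u f c => [|d IH] u f c u0 u1 Hu sf fc c0 cq.
  rewrite /= -[q in iota 0 q]subn0 -/(index_iota 0 q) big_mkord.
  rewrite (eq_bigr (fun x : 'I_q => cosT (c%:~R / q%:R * x%:R + f`_0))).
    rewrite sum_cosT_period//; last by move: cq; rewrite !muln1.
    by rewrite normr0 !mulr_ge0.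
  move=> x _; rewrite (horner_coef_wide _ sf) big_ord_recl big_ord1 /= expr0 mulr1.
  by rewrite fc expr1 addrC.
set Y := box_sums H q d; set Ny : R := (size Y)%:R.
have Ny0 : 0 <= Ny by rewrite ler0n.
have HR : 0 < H%:R :> R by rewrite ltr0n.
have u20 : 0 <= u ^+ 2 by rewrite exprn_ge0.
have u21 : u ^+ 2 <= 1 by rewrite expr_le1.
have Hu2 : H%:R^-1 <= (u ^+ 2) ^+ (2 ^ d) by rewrite -exprM -expnS.
have Hu1 : 1 <= u ^+ 2 * H%:R.
  rewrite -ler_pdivrMr// mul1r; apply: le_trans Hu2 _.
  rewrite -[leRHS]expr1; apply: ler_wiXn2l => //.
  by rewrite expn_gt0.
have pair_le (x x' : 'I_H) :
    \sum_(y <- Y) cosT (f.[(x + y)%:R] - f.[(x' + y)%:R]) <=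
    ((x == x')%:R + 2 * u ^+ 2) * Ny.
  case: eqP => [->|/eqP xx'].
    apply: (@le_trans _ _ (\sum_(y <- Y) 1)).
      by apply: ler_sum => y _; exact: cosT_le1.
    rewrite big_const_seq count_predT iter_addr_0 -/Ny.
    rewrite -[leLHS]mul1r; apply: ler_wpM2r => //.
    by rewrite lerDl mulr_ge0.
  have [g [sg gd gE]] := shift_diff_poly x%:R x'%:R sf.
  rewrite add0r; apply: le_trans (IH _ g (c * d.+2%:Z * (x%:Z - x'%:Z)) u20 u21 Hu2 sg _ _ _).
  - apply: le_trans (ler_norm _).
    by under [leRHS]eq_bigr do rewrite gE -!natrD.
  - rewrite gd fc !rmorphM rmorphB /=; ring.
  - rewrite !mulf_neq0 // subr_eq0; apply: contra xx' => /eqP [] /eqP //.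
  - apply: leq_ltn_trans cq; rewrite !abszM.
    have xH : (`|x%:Z - x'%:Z| <= H)%N by have := ltn_ord x; have := ltn_ord x'; lia.
    rewrite [(d.+2)`!]factS expnS absz_nat.
    apply: (@leq_trans (`|c| * d.+2 * H * (d.+1)`! * H ^ d)); last by apply: eq_leq; ring.
    by rewrite !leq_mul.
rewrite size_box_sums expnS -mulnA -size_box_sums -/Y natrM -/Ny.
rewrite -ler_sqr ?nnegrE ?normr_ge0 ?mulr_ge0// real_normK ?num_real//.
rewrite big_box_sums exchange_big /=.
apply: le_trans (sqr_sum_le_size _ _) _; rewrite -/Y -/Ny.
have step : \sum_(y <- Y) (\sum_(x < H) cosT f.[(x + y)%:R]) ^+ 2 <=
    Ny * (H%:R + 2 * u ^+ 2 * H%:R * H%:R).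
  apply: (@le_trans _ _ (\sum_(y <- Y) \sum_(x < H) \sum_(x' < H)
      cosT (f.[(x + y)%:R] - f.[(x' + y)%:R]))).
    apply: ler_sum => y _.
    (* By the subtraction formula the double sum is the square of the cosine sum
       plus the square of the sine sum. *)
    under [leRHS]eq_bigr => x _ do under eq_bigr => x' _ do rewrite cosTB.
    under [leRHS]eq_bigr => x _ do rewrite big_split /= -!mulr_sumr.
    by rewrite big_split /= -!mulr_suml -!expr2 lerDl sqr_ge0.
  rewrite exchange_big /=; under eq_bigr => x _ do rewrite exchange_big /=.
  apply: (@le_trans _ _ (\sum_(x < H) \sum_(x' < H) ((x == x')%:R + 2 * u ^+ 2) * Ny)).
    by apply: ler_sum => x _; apply: ler_sum => x' _; exact: pair_le.
  have rowE (x : 'I_H) : \sum_(x' < H) ((x == x')%:R + 2 * u ^+ 2) * Ny =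
      (1 + 2 * u ^+ 2 * H%:R) * Ny.
    rewrite -mulr_suml big_split /= (bigD1 x)//= eqxx big1 => [|x' /negPf].
      by rewrite addr0 sumr_const card_ord mulr_natr.
    by rewrite eq_sym => ->.
  rewrite (eq_bigr _ (fun x _ => rowE x)) sumr_const card_ord.
  rewrite -[_ *+ H]mulr_natr le_eqVlt; apply/orP; left; apply/eqP; ring.
apply: le_trans (ler_wpM2l Ny0 step) _.
have -> : (2 * u * (H%:R * Ny)) ^+ 2 = Ny * (Ny * (4 * u ^+ 2 * H%:R ^+ 2)) by ring.
rewrite !ler_wpM2l//.
have : H%:R * 1 <= H%:R * (u ^+ 2 * H%:R) by rewrite ler_pM2l.
have : 0 <= H%:R * (u ^+ 2 * H%:R) by rewrite !mulr_ge0// ltW.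
nra.
Qed.

(** * From small trigonometric sums to many hits of a short arc *)

(** Mean value theorem on [[0, z]], where the cosine decreases. *)
Lemma le_mul_cos_sin (R : realType) (z : R) :
  0 <= z -> z <= pi / 2 -> z * cos z <= sin z.
Proof.
move=> z0 zpi; have pi0 : 0 < pi :> R := pi_gt0 R.
have [c] : exists2 c, c \in `[0, z]%R & sin z - sin 0 = cos c * (z - 0).
  apply: MVT_segment => //.
  by apply: continuous_subspaceT => x; exact: continuous_sin.
rewrite in_itv /= => /andP[c0 cz]; rewrite sin0 !subr0 mulrC => ->.
apply: ler_wpM2l => //; rewrite leNgt ltr_cos ?in_itv /= -?leNgt//.
  by apply/andP; split; lra.
by apply/andP; split; lra.
Qed.

(** The cosine determines the distance to the nearest integer: with
    [y = pi * g], the right side is [2 sin(y)^2], and halving the angle gives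
    [sin y >= y cos(y / 2)^2 >= y / 2 >= g] for [g] in [[0, 1/2]]. *)
Lemma sqr_le_1subcosT (R : realType) (g : R) : `|g| <= 2^-1 -> g ^+ 2 <= 1 - cosT g.
Proof.
wlog g0 : g / 0 <= g.
  move=> W; case: (ger0P g) => g0; first by move=> ?; apply: W; rewrite ?ger0_norm.
  move=> gle; rewrite -sqrrN -cosTN; apply: W; first by rewrite oppr_ge0 ltW.
  by rewrite normrN ltr0_norm.
rewrite ger0_norm// => g12; have pi2 : 2 <= pi :> R := pi_ge2 R.
have gpi : g * 2 <= g * pi by rewrite ler_wpM2l.
have gpi' : g * pi <= 2^-1 * pi by rewrite ler_wpM2r// pi_ge0.
set y : R := pi * g.
have -> : 1 - cosT g = 2 * sin y ^+ 2.
  have yE : 2 * pi * g = y *+ 2 by rewrite -mulr_natr /y; ring.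
  by rewrite /cosT yE cos_mulr2n cos2sin2 -mulr_natr; ring.
have y0 : 0 <= y by rewrite /y; nra.
have y1 : y <= pi / 2 by rewrite /y; lra.
have cy : 0 <= cos y.
  by apply: cos_ge0_pihalf; apply/andP; split => //; lra.
have siny : g <= sin y.
  have h0 : 0 <= y / 2 by lra.
  have /(le_mul_cos_sin h0) hs : y / 2 <= pi / 2 by lra.
  have ch : 0 <= cos (y / 2).
    by apply: cos_ge0_pihalf; apply/andP; split; lra.
  have yE : y = (y / 2) *+ 2 by rewrite -mulr_natr; field.
  have sE : sin y = 2 * (cos (y / 2) * sin (y / 2)).
    by rewrite {1}yE sin_mulr2n -mulr_natr mulrC.
  have cE : cos y = 2 * cos (y / 2) ^+ 2 - 1.
    by rewrite {1}yE cos_mulr2n -mulr_natr mulrC.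
  have : y / 2 * (2 * cos (y / 2) ^+ 2) <= sin y.
    rewrite sE; have := ler_wpM2l ch hs; nra.
  have : y / 2 * 1 <= y / 2 * (2 * cos (y / 2) ^+ 2) by rewrite ler_wpM2l//; lra.
  by rewrite /y in y0 y1 *; lra.
nra.
Qed.

Lemma cosT_gt_near_int (R : realType) (x rho : R) :
  0 < rho -> 1 - rho ^+ 2 < cosT x -> exists m : int, `|x - m%:~R| < rho.
Proof.
move=> rho0 xrho; exists (Num.floor (x + 2^-1)).
set m := Num.floor _; have /andP[mx xm] : m%:~R <= x + 2^-1 < (m + 1)%:~R by exact: floor_itv.
have g12 : `|x - m%:~R| <= 2^-1.
  by move: xm; rewrite rmorphD /= => xm; rewrite ler_norml; apply/andP; split; lra.
have := sqr_le_1subcosT g12.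
rewrite -mulrNz cosTDint => gx.
rewrite -ltr_sqr ?nnegrE ?normr_ge0 ?(ltW rho0)// real_normK ?num_real//.
by apply: le_lt_trans gx _; rewrite ltrBlDr addrC -ltrBlDr.
Qed.

Lemma cos_pow_expansion (R : realType) (phi : R) (N : nat) :
  (2 * cos phi) ^+ N =
  \sum_(j < N.+1) 'C(N, j)%:R * cos ((N%:R - 2 * j%:R) * phi).
Proof.
elim: N => [|N IH].
  by rewrite big_ord1 expr0 bin0 mulr0 subrr mul0r cos0 mulr1.
pose c (j : nat) := cos ((N.+1%:R - 2 * j%:R) * phi).
have prodcos (j : nat) :
    cos ((N%:R - 2 * j%:R) * phi) * (2 * cos phi) = c j + c j.+1.
  rewrite /c.
  have -> : (N.+1%:R - 2 * j%:R) * phi = (N%:R - 2 * j%:R) * phi + phi.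
    by rewrite -natr1; ring.
  have -> : (N.+1%:R - 2 * j.+1%:R) * phi = (N%:R - 2 * j%:R) * phi - phi.
    by rewrite -!natr1; ring.
  by rewrite cosD cosB; ring.
rewrite exprSr IH mulr_suml.
under eq_bigr => j _ do rewrite -mulrA prodcos mulrDr.
rewrite big_split /= [RHS]big_ord_recl /= bin0 mul1r.
have -> : \sum_(j < N.+1) 'C(N, j)%:R * c j =
    c 0%N + \sum_(j < N.+1) 'C(N, j.+1)%:R * c j.+1.
  rewrite big_ord_recl bin0 mul1r; congr (_ + _).
  by rewrite [RHS]big_ord_recr /= bin_small// mul0r addr0.
rewrite -addrA -big_split /=; congr (_ + _).
by apply: eq_bigr => j _; rewrite -mulrDl -natrD -binS.
Qed.

(** The mean over a period of the [N]-th power of [(1 + cosT x) / 2]. *)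
Definition central_mean (R : realType) (N : nat) : R := 'C(N.*2, N)%:R / 4 ^+ N.

Lemma central_meanS (R : realType) (N : nat) :
  central_mean R N.+1 * (N.*2.+2)%:R = central_mean R N * (N.*2.+1)%:R.
Proof.
have E : ('C(N.*2.+2, N.+1) * N.*2.+2 = 4 * 'C(N.*2, N) * N.*2.+1)%N.
  have := mul_bin_diag N.*2.+2 N; have := mul_bin_down N.*2.+1 N.
  rewrite /= -addnn; nia.
rewrite /central_mean doubleS exprS mulrAC -natrM E !natrM; field.
by rewrite expf_neq0// pnatr_eq0.
Qed.

(** The right side is nondecreasing in [N] and equals 1 for [N = 1]; hence
    [central_mean R N] decays no faster than [1 / (2 sqrt N)]. *)
Lemma central_mean_sqr_ge (R : realType) (N : nat) :
  (0 < N)%N -> 1 <= central_mean R N ^+ 2 * (4 * N%:R).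
Proof.
case: N => // N _; elim: N => [|N IH].
  have -> : central_mean R 1 = 2^-1.
    by rewrite /central_mean bin1 expr1 -[(1%N).*2]/2%N; field.
  by lra.
have := central_meanS R N.+1.
set c := central_mean R N.+1 in IH *; set c' := central_mean R N.+2.
have NR : 0 <= N%:R :> R by [].
have -> : (N.+1.*2.+2)%:R = 2 * N%:R + 4 :> R by rewrite -muln2 -!natr1 natrM -natr1; ring.
have -> : (N.+1.*2.+1)%:R = 2 * N%:R + 3 :> R by rewrite -muln2 -!natr1 natrM -natr1; ring.
move: IH; rewrite -[N.+2%:R]natr1 -[N.+1%:R]natr1; set x : R := N%:R in NR * => IH cc.
have -> : c' = c * (2 * x + 3) / (2 * x + 4) by rewrite -cc mulfK// gt_eqF//; lra.
apply: le_trans IH _.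
rewrite -subr_ge0.
have -> : (c * (2 * x + 3) / (2 * x + 4)) ^+ 2 * (4 * (x + 1 + 1)) - c ^+ 2 * (4 * (x + 1))
  = c ^+ 2 / (x + 2) by field; apply/andP; split; rewrite gt_eqF//; lra.
by rewrite divr_ge0 ?sqr_ge0//; lra.
Qed.

Lemma sum_bin (n : nat) : (\sum_(j < n.+1) 'C(n, j) = 2 ^ n)%N.
Proof.
rewrite -[2%N]/(1 + 1)%N expnDn; apply: eq_bigr => j _.
by rewrite !exp1n !muln1.
Qed.

(** Half-angles and the binomial theorem write the power as a convex combination
    of the cosines of frequency [m] with [|m| <= N]; frequency 0 gives the main
    term, and the weights of the others add up to at most 1. *)
Lemma sum_cosT_pow (R : realType) (T : Type) (s : seq T) (theta : T -> R)
    (N : nat) (delta : R) :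
  (forall m : int, m != 0 -> (`|m| <= N)%N ->
    `|\sum_(y <- s) cosT (m%:~R * theta y)| <= delta) -> 0 <= delta ->
  `|\sum_(y <- s) ((1 + cosT (theta y)) / 2) ^+ N - central_mean R N * (size s)%:R|
    <= delta.
Proof.
move=> small delta0.
pose w (j : nat) : R := 'C(N.*2, j)%:R / 4 ^+ N.
have w0 j : 0 <= w j by rewrite /w divr_ge0// exprn_ge0.
have powE (x : R) : ((1 + cosT x) / 2) ^+ N =
    \sum_(j < N.*2.+1) w j * cosT ((N%:Z - j%:Z)%:~R * x).
  have -> : (1 + cosT x) / 2 = (2 * cos (pi * x)) ^+ 2 / 4.
    have E : 2 * pi * x = (pi * x) *+ 2 by rewrite -mulr_natr; ring.
    by rewrite /cosT E cos_mulr2n -mulr_natr; field.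
  rewrite expr_div_n -exprM mul2n cos_pow_expansion mulr_suml.
  apply: eq_bigr => j _; rewrite /w /cosT mulrAC; congr (_ * _).
  have -> : (N.*2%:R - 2 * j%:R) * (pi * x) = 2 * pi * ((N%:Z - j%:Z)%:~R * x) :> R.
    have -> : N.*2%:R = 2 * N%:R :> R by rewrite -mul2n natrM.
    by rewrite rmorphB /=; ring.
  by [].
under eq_bigr do rewrite powE.
rewrite exchange_big /=.
have Nlt : (N < N.*2.+1)%N by rewrite ltnS -addnn leq_addr.
rewrite (bigD1 (Ordinal Nlt)) //=.
have -> : \sum_(y <- s) w N * cosT ((N%:Z - N%:Z)%:~R * theta y) =
    central_mean R N * (size s)%:R.
  rewrite -mulr_sumr subrr; congr (_ * _).
  under eq_bigr do rewrite mul0r /cosT mulr0 cos0.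
  by rewrite big_const_seq count_predT iter_addr_0.
rewrite addrAC subrr add0r.
apply: le_trans (ler_norm_sum _ _ _) _.
apply: (@le_trans _ _ (\sum_(j < N.*2.+1) w j * delta)).
  rewrite [leRHS](bigD1 (Ordinal Nlt)) //= ler_wpDl ?mulr_ge0//.
  apply: ler_sum => j jN; rewrite -mulr_sumr normrM ger0_norm// ler_wpM2l//.
  apply: small; last by have := ltn_ord j; lia.
  rewrite subr_eq0; apply: contra jN => /eqP [E].
  by apply/eqP/val_inj; rewrite /= -E.
rewrite -mulr_suml -mulr_suml -natr_sum sum_bin -muln2 mulnC expnM natrX.
by rewrite divff ?mul1r// expf_neq0// pnatr_eq0.
Qed.

(** The trigonometric polynomial
    [((1 + cos) / 2)^D * (cos - (1 - rho^2))], evaluated at [theta y], is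
    nonpositive outside the arc and at most [rho^2] inside it, so its sum is at
    most [rho^2] times the number of hits. Its mean is of the order of [rho^3]
    once [D] is about [4 / rho^2]: consecutive central means have ratio
    [1 - 1 / (2 (D + 1))], and [central_mean R D >= rho / 4]. The hypothesis makes
    the contribution of the nonzero frequencies smaller than this mean. *)
Lemma count_cosT_ge (R : realType) (T : Type) (s : seq T) (theta : T -> R) (rho : R) :
  0 < rho -> rho <= 1 ->
  (forall m : int, m != 0 -> `|m|%N%:R <= 5 / rho ^+ 2 ->
    `|\sum_(y <- s) cosT (m%:~R * theta y)| <= rho ^+ 3 / 64 * (size s)%:R) ->
  rho / 16 * (size s)%:R <= (count (fun y => 1 - rho ^+ 2 < cosT (theta y)) s)%:R.
Proof.
move=> rho0 rho1 small; set n : R := (size s)%:R; have n0 : 0 <= n by [].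
have r20 : 0 < rho ^+ 2 by rewrite exprn_gt0.
have r21 : rho ^+ 2 <= 1 by rewrite expr_le1// ltW.
set D := Num.truncn (4 / rho ^+ 2).
have d0 : 0 <= 4 / rho ^+ 2 by rewrite divr_ge0// ltW.
have /andP[Dle Dgt] : D%:R <= 4 / rho ^+ 2 < D.+1%:R by exact: truncn_itv.
have d4 : 4 <= 4 / rho ^+ 2 by rewrite ler_pdivlMr//; lra.
have D1 : (0 < D)%N.
  by rewrite -ltnS -(ltr_nat R); apply: le_lt_trans Dgt; lra.
have DS : D.+1%:R <= 5 / rho ^+ 2.
  have -> : 5 / rho ^+ 2 = 4 / rho ^+ 2 + 4 / rho ^+ 2 / 4 by field; rewrite gt_eqF.
  by rewrite -natr1; lra.
set delta := rho ^+ 3 / 64 * n.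
have delta0 : 0 <= delta by rewrite /delta mulr_ge0// divr_ge0// exprn_ge0// ltW.
have pw N : (N <= D.+1)%N ->
    `|\sum_(y <- s) ((1 + cosT (theta y)) / 2) ^+ N - central_mean R N * n| <= delta.
  move=> ND; apply: sum_cosT_pow => // m m0 mN; apply: small => //.
  by apply: le_trans DS; rewrite ler_nat (leq_trans mN).
have := pw _ (leqnn _); have := pw _ (leqnSn D).
rewrite !ler_distl => /andP[_ UD] /andP[LD _].
set c := central_mean R D in UD; set c' := central_mean R D.+1 in LD.
have cE : 2 * c' = c * (2 - D.+1%:R^-1).
  have := central_meanS R D; rewrite -/c -/c' => E.
  have DS0 : 0 < D.+1%:R :> R by rewrite ltr0n.
  have E2 : (D.*2.+2)%:R = 2 * D.+1%:R :> R by rewrite -doubleS -mul2n natrM.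
  have E1 : (D.*2.+1)%:R = 2 * D.+1%:R - 1 :> R by rewrite -E2 -[D.*2.+2%:R]natr1 addrK.
  have -> : c' = c * (2 * D.+1%:R - 1) / (2 * D.+1%:R).
    by rewrite -E1 -E E2 mulfK// mulf_neq0// gt_eqF.
  by field; rewrite gt_eqF.
have cge : rho / 4 <= c.
  have c0 : 0 <= c by rewrite /c divr_ge0// exprn_ge0.
  have := central_mean_sqr_ge R D1; rewrite -/c => c2.
  rewrite -ler_sqr ?nnegrE//; last by rewrite divr_ge0// ltW.
  have : 1 <= c ^+ 2 * (4 * (4 / rho ^+ 2)).
    by apply: le_trans c2 _; rewrite ler_wpM2l ?sqr_ge0// ler_wpM2l.
  have -> : c ^+ 2 * (4 * (4 / rho ^+ 2)) = c ^+ 2 * 16 / rho ^+ 2.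
    by field; rewrite gt_eqF.
  by rewrite ler_pdivlMr// mul1r => ?; rewrite expr_div_n; lra.
have Dinv : D.+1%:R^-1 <= rho ^+ 2 / 2.
  rewrite -[leRHS]invrK lef_pV2 ?posrE ?invr_gt0 ?divr_gt0 ?ltr0n//.
  rewrite invf_div; apply/ltW; apply: le_lt_trans Dgt.
  by rewrite ler_pM2r ?invr_gt0//; lra.
pose F y := 2 * ((1 + cosT (theta y)) / 2) ^+ D.+1
            - (2 - rho ^+ 2) * ((1 + cosT (theta y)) / 2) ^+ D.
have Fle : \sum_(y <- s) F y <=
    rho ^+ 2 * (count (fun y => 1 - rho ^+ 2 < cosT (theta y)) s)%:R.
  rewrite -sum1_count natr_sum [X in _ <= _ * X]big_mkcond /= mulr_sumr; apply: ler_sum => y _.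
  rewrite /F exprS; set u := (1 + cosT (theta y)) / 2.
  have u0 : 0 <= u by rewrite /u; have := cosT_geN1 (theta y); lra.
  have u1 : u <= 1 by rewrite /u; have := cosT_le1 (theta y); lra.
  have uD0 : 0 <= u ^+ D by rewrite exprn_ge0.
  have uD1 : u ^+ D <= 1 by rewrite exprn_ile1.
  have -> : 2 * (u * u ^+ D) - (2 - rho ^+ 2) * u ^+ D =
     u ^+ D * (cosT (theta y) - (1 - rho ^+ 2)) by rewrite /u; field.
  have := cosT_le1 (theta y).
  by case: ltP => hit ?; rewrite ?mulr1 ?mulr0; nra.
have Fge : c * rho ^+ 2 / 2 * n - 4 * delta <= \sum_(y <- s) F y.
  rewrite /F sumrB -!mulr_sumr.
  set U := \sum_(y <- s) _ ^+ D in UD *; set L := \sum_(y <- s) _ in LD *.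
  have cn : c * n * D.+1%:R^-1 <= c * n * (rho ^+ 2 / 2).
    by apply: ler_wpM2l => //; rewrite mulr_ge0//; lra.
  have : (2 - rho ^+ 2) * U <= (2 - rho ^+ 2) * (c * n + delta).
    by apply: ler_wpM2l => //; lra.
  have : 0 <= rho ^+ 2 * delta by rewrite mulr_ge0// ltW.
  have : 2 * (c' * n) = c * n * 2 - c * n * D.+1%:R^-1 by rewrite mulrA cE; ring.
  move: cn LD UD; clearbody c c' U L n delta.
  by move: (D.+1%:R^-1) => x; lra.
have : c * rho ^+ 2 / 2 * n - 4 * delta >= rho ^+ 2 * (rho / 16 * n).
  have : 0 <= (c - rho / 4) * (rho ^+ 2 * n) by rewrite !mulr_ge0// ?subr_ge0// ltW.
  by rewrite /delta exprS; lra.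
by move=> /le_trans /(_ Fge) /le_trans /(_ Fle); rewrite ler_pM2l.
Qed.

(** * Hitting sets *)

(** By double counting some entry of [s] hits at least a proportion [alpha] of
    the indices not hit yet; choosing such an entry [n] times shrinks the set of
    missed indices geometrically. *)
Lemma greedy_hitting (R : realFieldType) (T : eqType) (s : seq T) (Phi : finType)
    (hit : Phi -> pred T) (alpha : R) (n : nat) :
  (0 < size s)%N -> alpha <= 1 ->
  (forall phi, alpha * (size s)%:R <= (count (hit phi) s)%:R) ->
  exists r : seq T, [/\ size r = n, {subset r <= s} &
    #|[pred phi | ~~ has (hit phi) r]|%:R <= (1 - alpha) ^+ n * #|Phi|%:R].
Proof.
move=> s0 alpha1 dense; elim: n => [|n [r [rn rs rle]]].
  by exists [::]; split => //; rewrite expr0 mul1r ler_nat max_card.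
set U := [pred phi | ~~ has (hit phi) r] in rle *.
have : has (fun k => alpha * #|U|%:R <= #|[pred phi in U | hit phi k]|%:R) s.
  apply/negPn/negP; rewrite -all_predC => /allP few.
  have : \sum_(k <- s | k \in s) #|[pred phi in U | hit phi k]|%:R
      < \sum_(k <- s | k \in s) alpha * #|U|%:R.
    apply: ltr_sum => [|k ks]; first by case: (s) s0 => //= k s' _; rewrite mem_head.
    by rewrite ltNge; exact: few.
  apply/negP; rewrite -leNgt -!big_seq big_const_seq count_predT iter_addr_0.
  under [leRHS]eq_bigr do rewrite -sum1_card natr_sum big_mkcondr.
  rewrite exchange_big /=.
  have -> : alpha * #|U|%:R *+ size s = \sum_(phi in U) alpha * (size s)%:R.
    by rewrite sumr_const -[RHS]mulr_natr -[LHS]mulr_natr mulrAC.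
  apply: ler_sum => phi _.
  by rewrite -big_mkcond /= -natr_sum sum1_count.
case/hasP => k ks many; exists (k :: r); split.
- by rewrite /= rn.
- by move=> x; rewrite inE => /orP[/eqP ->|/rs].
have -> : #|[pred phi | ~~ has (hit phi) (k :: r)]| =
    (#|U| - #|[pred phi in U | hit phi k]|)%N.
  rewrite -[in RHS](cardID (mem [pred phi | hit phi k]) U).
  rewrite addKn.
  by apply: eq_card => phi; rewrite !inE /= negb_or.
rewrite natrB; last by apply: subset_leq_card; apply/fintype.subsetP => phi; rewrite !inE => /andP[].
rewrite exprS -mulrA; apply: (@le_trans _ _ ((1 - alpha) * #|U|%:R)).
  by rewrite mulrBl mul1r lerB.
by rewrite ler_wpM2l// subr_ge0.
Qed.

Lemma fset_int_extend (X : {fset int}) (n : nat) :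
  (#|` X| <= n)%N -> exists2 Y : {fset int}, (X `<=` Y)%fset & #|` Y| = n.
Proof.
elim: n => [|n IH] Xn; first by exists X => //; apply/eqP; rewrite -leqn0.
case: (eqVneq #|` X| n.+1) => [|Xn']; first by exists X.
have [|Y XY Yn] := IH; first by rewrite -ltnS ltn_neqAle Xn'.
pose z : int := (\sum_(y <- Y) `|y|%N).+1%:Z.
have zY : z \notin Y.
  apply/negP => zY; have : (`|z| <= \sum_(y <- Y) `|y|)%N.
    by rewrite (big_rem z zY) leq_addr.
  by rewrite ltnn.
exists (z |` Y)%fset; first exact: fsubset_trans XY (fsubsetUr _ _).
by rewrite cardfsU1 zY Yn.
Qed.

(** All frequencies [m] needed by the counting lemma are at most [5 / rho^2], and
    [m *: f] has leading coefficient [m / q], so one modulus [q] suits them all.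
    The bound is uniform in the lower coefficients of [f]. *)
Lemma box_sums_dense (R : realType) (d H q : nat) (rho : R) (f : {poly R}) :
  (0 < H)%N -> 0 < rho -> rho <= 1 ->
  H%:R^-1 <= (rho ^+ 3 / 128) ^+ (2 ^ d) ->
  5 / rho ^+ 2 * ((d.+1)`! * H ^ d)%:R < q%:R ->
  (size f <= d.+2)%N -> f`_d.+1 = q%:R^-1 ->
  rho / 16 * (size (box_sums H q d))%:R <=
    (count (fun k => 1 - rho ^+ 2 < cosT f.[k%:R]) (box_sums H q d))%:R.
Proof.
move=> H0 rho0 rho1 Hle qgt sf fq; apply: count_cosT_ge => // m m0 mle.
under eq_bigr do rewrite -hornerZ.
have r3 : 0 <= rho ^+ 3 <= 1 by rewrite exprn_ge0 ?exprn_ile1// ltW.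
have -> : rho ^+ 3 / 64 = 2 * (rho ^+ 3 / 128) by field.
apply: (@weyl_box_sums _ _ _ _ _ _ m) => //; try lra.
- exact: leq_trans (size_scale_leq _ _) sf.
- by rewrite coefZ fq.
- rewrite -(ltr_nat R); apply: le_lt_trans qgt.
  by rewrite -mulnA natrM ler_wpM2r.
Qed.

Lemma round_to_grid (R : realType) (Q : nat) (x : R) : (0 < Q)%N ->
  exists b : 'I_Q, exists m : int, 0 <= x - m%:~R - b%:R / Q%:R <= Q%:R^-1.
Proof.
move=> Q0; have QR : 0 < Q%:R :> R by rewrite ltr0n.
set m := Num.floor x; have /andP[mx xm] : m%:~R <= x < (m + 1)%:~R by exact: floor_itv.
have y0 : 0 <= (x - m%:~R) * Q%:R by rewrite mulr_ge0// ?subr_ge0// ltW.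
have := truncn_itv y0; set b := Num.truncn _ => /andP[by_ yb].
have bQ : (b < Q)%N.
  rewrite -(ltr_nat R); apply: le_lt_trans by_ _.
  by rewrite -[ltRHS]mul1r ltr_pM2r//; move: xm; rewrite rmorphD /=; lra.
exists (Ordinal bQ), m => /=.
have yE : x - m%:~R = (x - m%:~R) * Q%:R / Q%:R by rewrite mulfK// gt_eqF.
rewrite yE -mulrBl; set y := _ * Q%:R in by_ yb *.
apply/andP; split; first by rewrite mulr_ge0 ?invr_ge0 ?subr_ge0// ltW.
by rewrite -[leRHS]mul1r ler_pM2r ?invr_gt0//; move: yb; rewrite -natr1; lra.
Qed.

(** Lower coefficients on the grid of mesh [1 / Q] give only [Q ^ d.+1]
    polynomials, each of which brings a proportion [rho / 16] of the box sums
    within [rho] of an integer. Greedy choice therefore hits all of them with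
    [n] points; repetitions are made up for by arbitrary further integers. *)
Lemma exists_net_hitting_set (R : realType) (d H q Q n : nat) (rho : R) :
  (0 < H)%N -> 0 < rho -> rho <= 1 ->
  H%:R^-1 <= (rho ^+ 3 / 128) ^+ (2 ^ d) ->
  5 / rho ^+ 2 * ((d.+1)`! * H ^ d)%:R < q%:R ->
  (1 - rho / 16) ^+ n * (Q ^ d.+1)%:R < 1 ->
  exists2 P : {fset int}, #|` P| = n &
    forall b : {ffun 'I_d.+1 -> 'I_Q}, exists k : nat,
      [/\ k%:Z \in P, (k <= d * H + q)%N & exists m : int,
        `|q%:R^-1 * k%:R ^+ d.+1 + \sum_(i < d.+1) (b i)%:R / Q%:R * k%:R ^+ i
          - m%:~R| < rho].
Proof.
move=> H0 rho0 rho1 Hle qgt few.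
have q0 : (0 < q)%N.
  rewrite -(ltr_nat R); apply: le_lt_trans qgt.
  by rewrite mulr_ge0// divr_ge0// exprn_ge0// ltW.
set S := box_sums H q d.
have S0 : (0 < size S)%N by rewrite size_box_sums muln_gt0 expn_gt0 H0.
pose f (b : {ffun 'I_d.+1 -> 'I_Q}) : {poly R} :=
  q%:R^-1 *: 'X^(d.+1) + \sum_(i < d.+1) ((b i)%:R / Q%:R) *: 'X^i.
have small_sum (b : {ffun 'I_d.+1 -> 'I_Q}) :
    (size (\sum_(i < d.+1) ((b i)%:R / Q%:R : R) *: 'X^i : {poly R})%R <= d.+1)%N.
  apply: (leq_trans (size_sum _ _ _)); apply/bigmax_leqP => i _.
  by apply: (leq_trans (size_scale_leq _ _)); rewrite size_polyXn.
pose hit b k := 1 - rho ^+ 2 < cosT (f b).[k%:R].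
have dense b : rho / 16 * (size S)%:R <= (count (hit b) S)%:R.
  apply: box_sums_dense => //.
  - apply: (leq_trans (size_polyD _ _)); rewrite geq_max.
    rewrite (leq_trans (size_scale_leq _ _)) ?size_polyXn//=.
    exact: leq_trans (small_sum b) _.
  - rewrite coefD coefZ coefXn eqxx mulr1 [X in _ + X]nth_default ?addr0//.
have rho16 : rho / 16 <= 1 by lra.
have [r [rn rS rle]] := greedy_hitting n S0 rho16 dense.
have [|P rP Pn] := @fset_int_extend [fset x in [seq k%:Z | k <- r]]%fset n.
  by rewrite card_fseq (leq_trans (size_undup _))// size_map rn.
exists P => // b.
have /hasP[k kr] : has (hit b) r.
  apply/negPn/negP => nohit.
  have : #|[pred phi | ~~ has (hit phi) r]|%:R < 1%:R :> R.
    by apply: le_lt_trans rle _; rewrite card_ffun !card_ord.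
  by rewrite ltr_nat ltnS leqn0 => /eqP /card0_eq /(_ b); rewrite inE nohit.
move=> /(cosT_gt_near_int rho0) [m km].
exists k; split; first by by apply: (fsubsetP rP); rewrite inE map_f.
  by apply: box_sums_le; exact: rS.
exists m; move: km; rewrite /f hornerD hornerZ hornerXn horner_sum.
by under eq_bigr do rewrite hornerZ hornerXn.
Qed.

(** Modulo 1 every real coefficient is within [1 / Q] of the grid. On the box
    sums this moves the values by at most
    [(d + 1) (d H + q)^d / Q <= rho], which doubles the radius. *)
Lemma exists_hitting_set (R : realType) (d H q Q n : nat) (rho : R) :
  (0 < H)%N -> 0 < rho -> rho <= 1 ->
  H%:R^-1 <= (rho ^+ 3 / 128) ^+ (2 ^ d) ->
  5 / rho ^+ 2 * ((d.+1)`! * H ^ d)%:R < q%:R ->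
  (0 < Q)%N -> (d.+1 * (d * H + q) ^ d)%:R <= rho * Q%:R ->
  (1 - rho / 16) ^+ n * (Q ^ d.+1)%:R < 1 ->
  exists2 P : {fset int}, #|` P| = n &
    forall B : nat -> R, exists k m : int, k \in P /\
      `|q%:R^-1 * k%:~R ^+ d.+1 + \sum_(i < d.+1) B i * k%:~R ^+ i - m%:~R|
        < 2 * rho.
Proof.
move=> H0 rho0 rho1 Hle qgt Q0 Qge few.
have q0 : (0 < q)%N.
  rewrite -(ltr_nat R); apply: le_lt_trans qgt.
  by rewrite mulr_ge0// divr_ge0// exprn_ge0// ltW.
have QR : 0 < Q%:R :> R by rewrite ltr0n.
have [P Pn hitP] := exists_net_hitting_set H0 rho0 rho1 Hle qgt few.
exists P => // B.
have [b' b'P] := fin_all_exists (fun i : 'I_d.+1 => round_to_grid (B i) Q0).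
have [m' m'P] := fin_all_exists b'P.
have [k [kP kM [m km]]] := hitP (finfun b').
exists k%:Z, (m + \sum_(i < d.+1) m' i * k%:Z ^+ i); split => //.
set X := q%:R^-1 * _ in km *; rewrite -[k%:Z%:~R]/(k%:R).
pose err (i : 'I_d.+1) : R := B i - (m' i)%:~R - (b' i)%:R / Q%:R.
have sumE : \sum_(i < d.+1) B i * k%:R ^+ i =
    \sum_(i < d.+1) (finfun b' i)%:R / Q%:R * k%:R ^+ i
    + (\sum_(i < d.+1) m' i * k%:Z ^+ i)%:~R + \sum_(i < d.+1) err i * k%:R ^+ i.
  rewrite rmorph_sum -!big_split /=; apply: eq_bigr => i _.
  by rewrite ffunE rmorphM rmorphXn /= /err; ring.
have errle : `|\sum_(i < d.+1) err i * k%:R ^+ i| <= rho.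
  apply: le_trans (ler_norm_sum _ _ _) _.
  apply: (@le_trans _ _ (\sum_(i < d.+1) Q%:R^-1 * ((d * H + q) ^ d)%:R)).
    apply: ler_sum => i _; have /andP[e0 e1] := m'P i.
    rewrite -/(err i) in e0 e1.
    have k0 : 0 <= k%:R ^+ i :> R by rewrite exprn_ge0.
    rewrite normrM (ger0_norm e0) (ger0_norm k0).
    apply: ler_pM => //.
    rewrite -natrX ler_nat; apply: (@leq_trans ((d * H + q) ^ i)).
      by case: (nat_of_ord i) => // j; rewrite leq_exp2r.
    by rewrite leq_pexp2l ?addn_gt0 ?q0 ?orbT// -ltnS.
  rewrite sumr_const card_ord -[_ *+ d.+1]mulr_natr mulrAC -mulrA mulrC ler_pdivrMr//.
  by rewrite -natrM.
rewrite sumE rmorphD /=; set a := \sum_(i < _) _ in km *; set e := \sum_(i < _) _ in errle *.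
set z := (\sum_(i < _) _)%:~R.
have -> : X + (a + z + e) - (m%:~R + z) = (X + a - m%:~R) + e by ring.
apply: le_lt_trans (ler_normD _ _) _.
have -> : 2 * rho = rho + rho by ring.
exact: ltr_leD.
Qed.

(** * Intervals on the torus *)

(** On arbitrary sets the Lebesgue measure takes the values of the outer measure
    it comes from, so monotonicity holds without measurability. *)
Lemma le_lebesgue_measure (R : realType) (A B : set R) :
  A `<=` B -> (lebesgue_measure A <= lebesgue_measure B)%E.
Proof. by move=> AB; apply: (@le_mu_ext _ _ _ (wlength idfun)). Qed.

(** If two points of [I] are at distance at least [eps / 8], their midpoint is
    such a center. If all are closer than [eps / 8], the preimage of the
    projection in [[0, 1)] lies in three translates, by -1, 0 and 1, of an
    interval of length [eps / 4], so its measure is at most [3 eps / 4]. *)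
Lemma torus_interval_center (R : realType) (I : set R) (eps : R) :
  0 < eps -> eps <= 1 -> is_interval I ->
  torus_length (@torus_proj R @` I) = eps%:E ->
  exists t : R, forall z : R, `|z - t| <= eps / 16 -> I z.
Proof.
move=> eps0 eps1 itvI len.
have [[x [y [Ix Iy xy]]]|noxy] :=
    pselect (exists x y, [/\ I x, I y & eps / 8 <= y - x]).
  exists ((x + y) / 2) => z; rewrite ler_norml => /andP[z1 z2].
  by apply: (itvI x y Ix Iy); apply/andP; split; lra.
have close x y : I x -> I y -> `|y - x| < eps / 8.
  move=> Ix Iy; rewrite ltNge; apply/negP => far; apply: noxy.
  have [yx|yx] := lerP 0 (y - x).
    by exists x, y; split => //; move: far; rewrite ger0_norm.
  by exists y, x; split => //; move: far; rewrite ltr0_norm// opprB.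
have [[x0 Ix0]|I0] := pselect (exists x, I x); last first.
  have I00 : I = set0 by rewrite -subset0 => x Ix; apply: I0; exists x.
  move: len; rewrite I00 image_set0 /torus_length preimage_set0 setI0 measure0.
  by move=> /eqP; rewrite eqe lt_eqF.
pose c := x0 - (Num.floor x0)%:~R.
have /andP[f1 f2] := floor_itv x0.
have c01 : 0 <= c /\ c < 1 by move: f2; rewrite /c rmorphD /=; lra.
pose S (j : R) : set R := `[c + j - eps / 8, c + j + eps / 8]%classic.
have sub : `[0, 1[ `&` @torus_proj R @^-1` (@torus_proj R @` I) `<=`
    S (-1) `|` S 0 `|` S 1.
  move=> z [] /=; rewrite in_itv /= => /andP[z0 z1] [w Iw] /torus_projP [m wz].
  have /ltr_normlP[w1 w2] := close _ _ Ix0 Iw.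
  have zE : z = c + (Num.floor x0 - m)%:~R + (w - x0).
    by rewrite /c rmorphB /= -wz; ring.
  set j := Num.floor x0 - m in zE.
  have j1 : (-2)%:~R < j%:~R :> R by lra.
  have j2 : j%:~R < 2%:~R :> R by lra.
  move: j1 j2; rewrite !ltr_int => j1 j2.
  have [jE|[jE|jE]] : j = -1 \/ j = 0 \/ j = 1 by lia.
  - by left; left; rewrite /S /= in_itv /=; move: zE; rewrite jE => zE; apply/andP; split; lra.
  - by left; right; rewrite /S /= in_itv /=; move: zE; rewrite jE => zE; apply/andP; split; lra.
  - by right; rewrite /S /= in_itv /=; move: zE; rewrite jE => zE; apply/andP; split; lra.
have Slen j : lebesgue_measure (S j) = (eps / 4)%:E.
  rewrite lebesgue_measure_itv /= lte_fin.
  have -> : c + j - eps / 8 < c + j + eps / 8 by lra.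
  by rewrite -EFinB; congr _%:E; field.
have mS j : measurable (S j) by exact: measurable_itv.
have : (torus_length (@torus_proj R @` I) <= (eps / 4 + eps / 4 + eps / 4)%:E)%E.
  apply: le_trans (le_lebesgue_measure sub) _.
  apply: le_trans (measureU2 (@lebesgue_measure R)
    (measurableU _ _ (mS (-1)) (mS 0)) (mS 1)) _.
  rewrite !EFinD -{3}(Slen 1) -{1}(Slen (-1)) -(Slen 0) leeD//.
  exact: (measureU2 (@lebesgue_measure R) (mS (-1)) (mS 0)).
by rewrite len lee_fin; lra.
Qed.

(** * Choice of the parameters *)
Lemma ln_nat_ge_half (R : realType) (n : nat) : (2 <= n)%N -> 2^-1 <= ln n%:R :> R.
Proof.
move=> n2; have nR : 2 <= n%:R :> R by rewrite ler_nat.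
have n0 : 0 < n%:R :> R by lra.
have ni : n%:R^-1 <= 2^-1 :> R by rewrite lef_pV2 ?posrE.
have ni0 : 0 < n%:R^-1 :> R by rewrite invr_gt0.
have : ln (1 + (n%:R^-1 - 1)) <= n%:R^-1 - 1 :> R by apply: le_ln1Dx; lra.
by rewrite addrC subrK lnV ?posrE//; lra.
Qed.

Lemma ln_le_2sqrt (R : realType) (x : R) : 0 < x -> ln x <= 2 * Num.sqrt x.
Proof.
move=> x0; have s0 : 0 < Num.sqrt x by rewrite sqrtr_gt0.
rewrite -{1}(sqr_sqrtr (ltW x0)) lnXn// -[ln _ *+ 2]mulr_natl ler_wpM2l//.
exact/ltW/ln_sublinear.
Qed.

Lemma mul_ln_le (R : realType) (K x : R) :
  0 <= K -> 0 < x -> (2 * K) ^+ 2 <= x -> K * ln x <= x.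
Proof.
move=> K0 x0 Kx.
have s0 : 0 <= Num.sqrt x by exact: sqrtr_ge0.
have Ks : 2 * K <= Num.sqrt x.
  by rewrite -ler_sqr ?nnegrE ?mulr_ge0// sqr_sqrtr// ltW.
apply: (le_trans (ler_wpM2l K0 (ln_le_2sqrt x0))).
rewrite -[leRHS](sqr_sqrtr (ltW x0)); nra.
Qed.

(** The side, the modulus and the grid size are the powers of [n] with these
    exponents. The number of grid polynomials is then a fixed power of [n],
    whose exponent is known before [K] is chosen. *)
Definition side_exp (d : nat) : nat := 4 * 2 ^ d.
Definition modulus_exp (d : nat) : nat := 3 + side_exp d * d.+1.
Definition grid_exp (d : nat) : nat := (modulus_exp d).+1 * d + 2.

Lemma side_expP (R : realType) (d n : nat) (rho : R) :
  (128 <= n)%N -> n%:R^-1 <= rho ->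
  (n ^ side_exp d)%:R^-1 <= (rho ^+ 3 / 128) ^+ (2 ^ d).
Proof.
move=> n128 nrho; have nR : 128 <= n%:R :> R by rewrite ler_nat.
have ni0 : 0 < n%:R^-1 :> R by rewrite invr_gt0; lra.
rewrite expnM natrX -exprVn; apply: lerXn2r.
- by rewrite nnegrE invr_ge0.
- by rewrite nnegrE divr_ge0// exprn_ge0//; lra.
rewrite natrX -exprVn exprSr; apply: ler_pM => //.
- by apply: lerXn2r => //; rewrite nnegrE; lra.
- by rewrite lef_pV2 ?posrE//; lra.
Qed.

Lemma modulus_expP (R : realType) (d n : nat) (rho : R) :
  (5 * (d.+1)`! < n)%N -> n%:R^-1 <= rho ->
  5 / rho ^+ 2 * ((d.+1)`! * (n ^ side_exp d) ^ d)%:R < (n ^ modulus_exp d)%:R.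
Proof.
move=> nf nrho; have n0 : (0 < n)%N by exact: leq_ltn_trans nf.
have nR : 0 < n%:R :> R by rewrite ltr0n.
have ni0 : 0 < n%:R^-1 :> R by rewrite invr_gt0.
have r2 : (rho ^+ 2)^-1 <= n%:R ^+ 2.
  rewrite -exprVn; apply: lerXn2r; rewrite ?nnegrE ?invr_ge0//; first by lra.
  by rewrite -[leRHS]invrK lef_pV2 ?posrE//; lra.
apply: (@le_lt_trans _ _ (5 * n%:R ^+ 2 * ((d.+1)`! * (n ^ side_exp d) ^ d)%:R)).
  by apply: ler_wpM2r => //; apply: ler_wpM2l.
rewrite -natrX -!natrM ltr_nat /modulus_exp mulnS (expnD n 3) (expnD n (side_exp d)) -expnM.
have A0 : (0 < n ^ (side_exp d * d))%N by rewrite expn_gt0 n0.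
have B0 : (0 < n ^ side_exp d)%N by rewrite expn_gt0 n0.
rewrite [(n ^ 3)%N]expnSr.
apply: (@leq_trans (n ^ 2 * n * (n ^ (side_exp d * d)))).
  have -> : (5 * n ^ 2 * ((d.+1)`! * n ^ (side_exp d * d)) =
      n ^ 2 * (5 * (d.+1)`!) * n ^ (side_exp d * d))%N by ring.
  by rewrite ltn_pmul2r// ltn_pmul2l// expn_gt0 n0.
by rewrite leq_pmul2l ?muln_gt0 ?expn_gt0 ?n0// leq_pmull.
Qed.

Lemma grid_expP (R : realType) (d n : nat) (rho : R) :
  (d < n)%N -> n%:R^-1 <= rho ->
  (d.+1 * (d * n ^ side_exp d + n ^ modulus_exp d) ^ d)%:R <= rho * (n ^ grid_exp d)%:R.
Proof.
move=> dn nrho; have n0 : (0 < n)%N by exact: leq_ltn_trans dn.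
have nR : 0 < n%:R :> R by rewrite ltr0n.
apply: (@le_trans _ _ (n%:R^-1 * (n ^ grid_exp d)%:R)); last by rewrite ler_wpM2r.
have -> : n%:R^-1 * (n ^ grid_exp d)%:R = (n ^ ((modulus_exp d).+1 * d).+1)%:R :> R.
  rewrite /grid_exp addn2 [(n ^ _.+2)%N]expnS natrM mulrA mulVf ?mul1r//.
  by rewrite gt_eqF.
rewrite ler_nat expnS expnM; apply: leq_mul => //.
case: (posnP d) => [->|d0]; first by rewrite !expn0.
rewrite leq_exp2r// expnS.
apply: (@leq_trans (d.+1 * n ^ modulus_exp d)); last by rewrite leq_mul2r dn orbT.
rewrite mulSn addnC leq_add2l leq_mul2l leq_pexp2l ?orbT//.
by rewrite /modulus_exp mulnS addnCA leq_addr.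
Qed.

(** Since [1 - x <= exp (- x)], the power is at most [n ^- C.+1]. *)
Lemma decay_lt1 (R : realType) (n C : nat) (x : R) :
  (1 < n)%N -> x <= 1 -> x * n%:R = C.+1%:R * ln n%:R ->
  (1 - x) ^+ n * (n ^ C)%:R < 1.
Proof.
move=> n1 x1 xn; have nR : 1 < n%:R :> R by rewrite ltr1n.
have n0 : 0 < n%:R :> R by lra.
apply: (@le_lt_trans _ _ (expR (- x) ^+ n * (n ^ C)%:R)).
  apply: ler_wpM2r => //; apply: lerXn2r; rewrite ?nnegrE ?subr_ge0 ?expR_ge0//.
  exact: expR_ge1Dx.
rewrite -expRM_natr mulNr xn expRN expRM_natl lnK ?posrE// exprS natrX.
by rewrite invfM mulfVK ?invf_lt1// expf_neq0// gt_eqF.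
Qed.

Theorem proposition5 (R : realType) (p : nat) (hp : (1 <= p)%N) :
  exists2 K : R, 0 < K &
    \forall n \near \oo,
      exists (P : {fset int}) (A : R), #|` P|%fset = n /\
        forall (B : nat -> R) (J : set (torus R)),
          torus_interval J ->
          torus_length J = (K * (ln n%:R / n%:R))%:E ->
          torus_poly_set p P A B `&` J !=set0.
Proof.
case: p hp => // d _.
pose C := (grid_exp d * d.+1)%N.
(* A hit has density [rho / 16] with [rho = eps / 32], that is [eps / 512], and
   [n] greedy steps must beat the [n ^ C] polynomials of the grid. *)
pose K : R := 512 * C.+1%:R.
have C1 : 1 <= C.+1%:R :> R by rewrite ler1n.
have K512 : 512 <= K by rewrite /K; lra.
exists K; first by lra.
exists (128 + d + 5 * (d.+1)`! + (Num.truncn ((2 * K) ^+ 2)))%N.+1 => // n /= nN.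
have n128 : (128 <= n)%N by lia.
have dn : (d < n)%N by lia.
have fn : (5 * (d.+1)`! < n)%N by lia.
have nK : (2 * K) ^+ 2 <= n%:R.
  apply/ltW; apply: lt_le_trans (truncnS_gt _) _; rewrite ler_nat.
  by apply: leq_trans nN; rewrite ltnS leq_addl.
have nR : 0 < n%:R :> R by rewrite ltr0n; lia.
have lnn : 2^-1 <= ln n%:R :> R by apply: ln_nat_ge_half; lia.
set eps := K * (ln n%:R / n%:R).
have epsn : eps * n%:R = K * ln n%:R by rewrite /eps; field; rewrite gt_eqF.
have eps1 : eps <= 1.
  by rewrite -(ler_pM2r nR) epsn mul1r; apply: mul_ln_le => //; lra.
have rhon : n%:R^-1 <= eps / 32.
  rewrite -(ler_pM2r nR) mulVf ?gt_eqF// mulrAC epsn; nra.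
have ni0 : 0 < n%:R^-1 :> R by rewrite invr_gt0.
have eps0 : 0 < eps by lra.
have [P Pn hitP] : exists2 P : {fset int}, #|` P| = n &
    forall B : nat -> R, exists k m : int, k \in P /\
      `|(n ^ modulus_exp d)%:R^-1 * k%:~R ^+ d.+1
        + \sum_(i < d.+1) B i * k%:~R ^+ i - m%:~R| < 2 * (eps / 32).
  apply: (@exists_hitting_set _ d (n ^ side_exp d) _ (n ^ grid_exp d)).
  - by rewrite expn_gt0; lia.
  - by lra.
  - by lra.
  - exact: side_expP.
  - exact: modulus_expP.
  - by rewrite expn_gt0; lia.
  - exact: grid_expP.
  - rewrite -expnM -/C; apply: decay_lt1; [lia|lra|].
    have -> : eps / 32 / 16 * n%:R = eps * n%:R / 512 by field.
    by rewrite epsn /K; field.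
exists P, (n ^ modulus_exp d)%:R^-1; split => // B _ [I itvI ->] len.
have [t tI] := torus_interval_center eps0 eps1 itvI len.
(* The constant coefficient [- t] moves the target [t] to the integers. *)
have [k [m [kP km]]] := hitP (fun i => if i is 0 then - t else B i).
set x := (n ^ modulus_exp d)%:R^-1 * k%:~R ^+ d.+1
  + \sum_(1 <= i < d.+1) B i * k%:~R ^+ i.
exists (torus_proj x); split; first by exists k.
exists (x - m%:~R); last first.
  by apply/torus_projP; exists (- m); rewrite mulrNz; ring.
apply: tI; have -> : eps / 16 = 2 * (eps / 32) by field.
apply/ltW; move: km; rewrite big_ord_recl expr0 mulr1 /=.
have -> : \sum_(i < d) B (bump 0 i) * k%:~R ^+ bump 0 i =
    \sum_(1 <= i < d.+1) B i * k%:~R ^+ i.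
  by rewrite big_add1 /= big_mkord.
suff -> : x - m%:~R - t = (n ^ modulus_exp d)%:R^-1 * k%:~R ^+ d.+1 +
    (- t + \sum_(1 <= i < d.+1) B i * k%:~R ^+ i) - m%:~R by [].
by rewrite /x; ring.
Qed.
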